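(* Up to automorphisms of $\Delta$, there is exactly one proper perfect dominating set $S$ in $\Delta$. Moreover, $S$ is a $1$-perfect code, and the minimum graph distance in $\Delta$ between two distinct vertices of $S$ is $\delta=3$.
   Context: $\Delta$ denotes the triangular lattice graph: its vertex set is $\{(x_1,x_2,x_3)\in\mathbb{Z}^3 : x_1+x_2+x_3=0\}$, and two vertices are adjacent iff their difference is one of $\pm(1,-1,0),\pm(1,0,-1),\pm(0,1,-1)$ (this is the graph of the regular tessellation of the plane by equilateral triangles, six at each vertex). ''Up to automorphisms of $\Delta$'' (up to symmetry) means up to the action of the full automorphism group of $\Delta$ (translations, rotations and reflections). A vertex subset $S$ of a graph $G$ is a perfect dominating set (PDS) if every vertex of $G$ not in $S$ is adjacent to exactly one vertex of $S$; a PDS is proper if it is not the whole vertex set. A $1$-perfect code is a PDS that is an independent set (no two of its vertices adjacent). *)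

(* Defs.v *)
From mathcomp Require Import all_boot all_order all_algebra.
From mathcomp Require Import boolp classical_sets.

Set Implicit Arguments.
Unset Strict Implicit.
Unset Printing Implicit Defensive.

Local Open Scope ring_scope.
Local Open Scope classical_set_scope.

Section Graph.
Variables (V : Type) (e : rel V).

Definition automorphism (f : V -> V) : Prop :=
  bijective f /\ {mono f : x y / e x y}.

Definition pds (S : set V) : Prop :=
  forall v, ~ S v -> exists! u, S u /\ e v u.

Definition proper_pds (S : set V) : Prop := pds S /\ S <> [set: V].

Definition independent (S : set V) : Prop :=
  forall x y, S x -> S y -> ~ e x y.

Definition perfect_code1 (S : set V) : Prop := pds S /\ independent S.

Definition walk (x y : V) (n : nat) : Prop :=
  exists p : seq V, [/\ path e x p, last x p = y & size p = n].

(* Relational, so that it holds for no [d] when [y] is unreachable from [x]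
   (infinite distance). *)
Definition is_dist (x y : V) (d : nat) : Prop :=
  walk x y d /\ forall n, walk x y n -> (d <= n)%N.

Definition is_min_dist (S : set V) (d : nat) : Prop :=
  (exists x y, [/\ S x, S y, x <> y & is_dist x y d]) /\
  (forall x y n, S x -> S y -> x <> y -> is_dist x y n -> (d <= n)%N).

End Graph.

Definition tri_vertex : Type :=
  {x : int * int * int | x.1.1 + x.1.2 + x.2 == 0}.

Definition tri_adj : rel tri_vertex := fun x y =>
  val y - val x \in [:: (1, -1, 0); (-1, 1, 0); (1, 0, -1);
                        (-1, 0, 1); (0, 1, -1); (0, -1, 1)].

(* Main.v *)
(** An edge [xy] of [S] forces the two common neighbours of [x] and [y] into
    [S], since they would otherwise have two neighbours in [S]; turning around
    the endpoints then fills the lattice.  So a proper PDS is independent, and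
    no two of its vertices are at distance 2.  Take axial coordinates, let [u]
    be a unit vector and [v] its rotation by 60 degrees.  For [x] in [S], the
    vertex [x + u + v] can only be dominated by [x + 2u + v] or [x + u + 2v].
    In the first case [x + 2v] can only be dominated by [x + 3v - u], which is
    the rotation of [x + 2u + v] about [x].  Hence the chirality is the same all
    over the plane and [S] is an index 7 sublattice or its mirror image. *)

Require Import Defs.
From mathcomp Require Import all_boot all_order all_algebra.
From mathcomp Require Import boolp classical_sets.
From mathcomp Require Import zify ring.

Set Implicit Arguments.
Unset Strict Implicit.
Unset Printing Implicit Defensive.

Import Order.TTheory GRing.Theory Num.Theory.

Local Open Scope ring_scope.
Local Open Scope classical_set_scope.

(** * Perfect dominating sets in an arbitrary graph *)

Section Graph.
Variables (V : Type) (e : rel V).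

Lemma automorphism_comp (f g : V -> V) :
  automorphism e f -> automorphism e g -> automorphism e (f \o g).
Proof.
move=> [bf mf] [bg mg]; split; first exact: bij_comp.
by move=> x y /=; rewrite mf mg.
Qed.

Lemma pds_preimage (f : V -> V) (S : set V) :
  automorphism e f -> pds e S -> pds e (f @^-1` S).
Proof.
move=> [[g fK gK] fm] pS v /pS[u [[Su vu] uniq_u]].
exists (g u); split => [|w [Sw vw]].
  by split; [rewrite /preimage/= gK | rewrite -fm gK].
by rewrite (uniq_u (f w)) ?fK // fm.
Qed.

Lemma proper_pds_preimage (f : V -> V) (S : set V) :
  automorphism e f -> proper_pds e S -> proper_pds e (f @^-1` S).
Proof.
move=> fA [pS Sn]; split; first exact: pds_preimage.
move=> fS; apply: Sn; have [[g fK gK] _] := fA.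
apply/seteqP; split=> // x _.
have : (f @^-1` S) (g x) by rewrite fS.
by rewrite /preimage /= gK.
Qed.

Lemma pds_uniq (S : set V) v x y :
  pds e S -> ~ S v -> S x -> S y -> e v x -> e v y -> x = y.
Proof.
move=> pS /pS[u [_ uniq_u]] Sx Sy vx vy.
by rewrite -(uniq_u x) // -(uniq_u y).
Qed.

(** Length 1 contradicts independence. At length 2 the midpoint is outside [S] by independence, yet
    has two neighbours in [S]. *)
Lemma perfect_code1_walk (S : set V) x y n :
  symmetric e -> perfect_code1 e S -> S x -> S y -> x <> y ->
  walk e x y n -> (3 <= n)%N.
Proof.
move=> esym [pS iS] Sx Sy xy [[|z [|w [|? ?]]] [/= exy lst <-]] //.
- by case/andP: exy; rewrite lst => /(iS _ _ Sx Sy).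
- case/and3P: exy; rewrite lst => xz zy _; case: xy.
  apply: (@pds_uniq S z) => //; last by rewrite esym.
  by move=> Sz; exact: iS Sx Sz xz.
Qed.

End Graph.

(** * Axial coordinates on the triangular lattice *)

Fact mk_subproof (a b : int) : (a, b, - a - b).1.1 + (a, b, - a - b).1.2
  + (a, b, - a - b).2 == 0.
Proof. by rewrite /=; lia. Qed.

Definition mk (a b : int) : tri_vertex := Sub (a, b, - a - b) (mk_subproof a b).
Definition cx (x : tri_vertex) : int := (val x).1.1.
Definition cy (x : tri_vertex) : int := (val x).1.2.

Lemma mkK x : mk (cx x) (cy x) = x.
Proof.
apply: val_inj; rewrite /= /cx /cy; case: x => [[[a b] c] /= abc].
by congr (_, _, _); lia.
Qed.

Lemma mk_inj a b c d : mk a b = mk c d -> a = c /\ b = d.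
Proof. by move=> /(congr1 val)[-> ->]. Qed.

Definition unit_step (p q : int) : bool :=
  [|| (p == 1) && (q == -1), (p == -1) && (q == 1), (p == 1) && (q == 0),
      (p == -1) && (q == 0), (p == 0) && (q == 1) | (p == 0) && (q == -1)].

(** Case analysis on this form substitutes concrete steps, after which goals on them compute. *)
Variant unit_step_spec : int -> int -> Prop :=
  | UnitStep1 : unit_step_spec 1 (-1)
  | UnitStep2 : unit_step_spec (-1) 1
  | UnitStep3 : unit_step_spec 1 0
  | UnitStep4 : unit_step_spec (-1) 0
  | UnitStep5 : unit_step_spec 0 1
  | UnitStep6 : unit_step_spec 0 (-1).

Lemma unit_stepP p q : unit_step p q -> unit_step_spec p q.
Proof.
by rewrite /unit_step; do ![case/orP|] => /andP[/eqP-> /eqP->]; constructor.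
Qed.

Lemma tri_adjE a b c d :
  tri_adj (mk a b) (mk c d) = unit_step (c - a) (d - b).
Proof.
rewrite /tri_adj /unit_step !inE /=.
have -> : (c, d, - c - d) - (a, b, - a - b) =
  (c - a, d - b, - c - d - (- a - b)) by [].
have -> : - c - d - (- a - b) = - ((c - a) + (d - b)) by ring.
move: (c - a) (d - b) => p q.
have pairE (k l m : int) : k + l + m = 0 ->
    ((p, q, - (p + q)) == (k, l, m)) = (p == k) && (q == l).
  move=> klm; rewrite !xpair_eqE.
  by case: eqP => // ->; case: eqP => //= ->; apply/eqP; lia.
by rewrite !pairE.
Qed.

Lemma tri_adjD a b p q :
  tri_adj (mk a b) (mk (a + p) (b + q)) = unit_step p q.
Proof. by rewrite tri_adjE ![_ + _ - _]addrAC !subrr !add0r. Qed.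

Lemma tri_adj_sym : symmetric tri_adj.
Proof.
move=> x y; rewrite -(mkK x) -(mkK y) !tri_adjE /unit_step; lia.
Qed.

(** * Propagation by rotations, and independence *)

(* [(p, q) |-> (- q, p + q)] is the rotation by 60 degrees. *)
Section Rotation.
Variables (S : set tri_vertex) (D : int -> int -> Prop).
Hypothesis D_rot : forall p q, D p q -> D (- q) (p + q).
Hypothesis S_rot : forall a b p q, D p q ->
  S (mk a b) -> S (mk (a + p) (b + q)) -> S (mk (a - q) (b + (p + q))).

Let edge a b p q := [/\ D p q, S (mk a b) & S (mk (a + p) (b + q))].

Let edge_rot a b p q : edge a b p q -> edge a b (- q) (p + q).
Proof. by case=> Dpq Sx Sy; split=> //; [exact: D_rot | exact: S_rot]. Qed.

Let edge_opp a b p q : edge a b p q -> edge a b (- p) (- q).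
Proof.
move=> /edge_rot /edge_rot /edge_rot.
by congr edge; lia.
Qed.

Let edge_shift a b p q : edge a b p q -> edge (a + p) (b + q) p q.
Proof.
move=> E; have [DN _ _] := edge_opp E; have [_ Sx Sy] := E.
rewrite -[p in edge _ _ p]opprK -[q in edge _ _ _ q]opprK.
by apply: edge_opp; split=> //; rewrite !addrK.
Qed.

Let edge_shiftz a b p q (i : int) :
  edge a b p q -> edge (a + i * p) (b + i * q) p q.
Proof.
move=> E; elim/int_ind: i => [|n /edge_shift|n /edge_opp/edge_shift/edge_opp].
- by rewrite !mul0r !addr0.
- by congr edge; rewrite intS; ring.
- by congr edge; rewrite ?intS; ring.
Qed.

(** Three rotations make a half turn, and a half turn about each endpoint in turn translates an edge
    along itself. Translate [i] times, rotate once, translate [j] times. Taking [unit_step] for [D]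
    fills the lattice, [chiral_step] an index 7 sublattice. *)
Lemma rotation_span a b p q (i j : int) :
  D p q -> S (mk a b) -> S (mk (a + p) (b + q)) ->
  S (mk (a + i * p - j * q) (b + i * q + j * (p + q))).
Proof.
move=> Dpq Sx Sy; have : edge a b p q by [].
move=> /(edge_shiftz i)/edge_rot/(edge_shiftz j)[_ + _].
by rewrite mulrN.
Qed.

End Rotation.

Lemma unit_step_rot p q : unit_step p q -> unit_step (- q) (p + q).
Proof. rewrite /unit_step; lia. Qed.

Lemma proper_pds_independent (S : set tri_vertex) :
  proper_pds tri_adj S -> independent tri_adj S.
Proof.
move=> [pS Sn] x y Sx Sy xy; apply: Sn; apply/seteqP; split=> // z _.
have S_rot a b p q : unit_step p q -> S (mk a b) -> S (mk (a + p) (b + q)) ->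
    S (mk (a - q) (b + (p + q))).
  move=> upq Sa Sb; apply: contrapT => Sc.
  have /mk_inj[] : mk a b = mk (a + p) (b + q).
    by apply: (pds_uniq pS Sc) => //; rewrite tri_adjE;
      move: upq; rewrite /unit_step; lia.
  by move: upq; rewrite /unit_step; lia.
pose p := cx y - cx x; pose q := cy y - cy x.
have upq : unit_step p q by rewrite -tri_adjE !mkK.
pose s := cx z - cx x; pose t := cy z - cy x.
(* [p ^ 2 + p q + q ^ 2 = 1], so [i] and [j] are the coordinates of [z - x] in
   the basis formed by [y - x] and its rotation. *)
pose i := s * (p + q) + t * q; pose j := t * p - s * q.
have -> : z = mk (cx x + i * p - j * q) (cy x + i * q + j * (p + q)).
  rewrite -[LHS]mkK; congr mk; rewrite /i /j.
  - suff: s = s * (p * p + p * q + q * q) by rewrite /s; lia.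
    by move: upq; rewrite /unit_step; nia.
  - suff: t = t * (p * p + p * q + q * q) by rewrite /t; lia.
    by move: upq; rewrite /unit_step; nia.
apply: (rotation_span (D := unit_step)) => //.
- exact: unit_step_rot.
- by rewrite mkK.
- by rewrite /p /q !subrKC mkK.
Qed.

(** * Local structure of perfect codes *)

Section PerfectCode.
Variable S : set tri_vertex.
Hypothesis pcS : perfect_code1 tri_adj S.

(* [(p, q)] is an intermediate step on a path of length 2 to be excluded. *)
Let apart a b s t p q :
  S (mk a b) -> S (mk (a + s) (b + t)) -> unit_step p q ->
  ~~ (unit_step s t || unit_step (s - p) (t - q) && ((s != 0) || (t != 0))).
Proof.
move=> Sx Sy pq; apply/negP => /orP[st|/andP[st n0]].
  by apply: (proj2 pcS _ _ Sx Sy); rewrite tri_adjD.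
have Nz : ~ S (mk (a + p) (b + q)).
  by move=> Sz; apply: (proj2 pcS _ _ Sx Sz); rewrite tri_adjD.
have /mk_inj[] : mk a b = mk (a + s) (b + t).
  apply: (pds_uniq (proj1 pcS) Nz) => //.
    by rewrite tri_adj_sym tri_adjD.
  suff -> : mk (a + s) (b + t) = mk (a + p + (s - p)) (b + q + (t - q)).
    by rewrite tri_adjD.
  by congr mk; ring.
by move: n0; lia.
Qed.

Let dominated a b : ~ S (mk a b) ->
  exists p q, unit_step p q /\ S (mk (a + p) (b + q)).
Proof.
move=> /(proj1 pcS)[u [[Su au] _]].
exists (cx u - a), (cy u - b); split; last by rewrite !subrKC mkK.
by rewrite -tri_adjE mkK.
Qed.

Lemma perfect_code1_chirality a b : S (mk a b) ->
  S (mk (a + 2) (b + 1)) \/ S (mk (a + 1) (b + 2)).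
Proof.
move=> Sx.
have /dominated[p [q [pq]]] : ~ S (mk (a + 1) (b + 1)).
  by move=> Sz; have := apart Sx Sz (isT : unit_step 1 0).
rewrite -!addrA => Sy.
(* Four of the six neighbours of [x + u + v] are within distance 2 of [x], through [x + u] or
   [x + v]. *)
have := apart Sx Sy (isT : unit_step 1 0).
have := apart Sx Sy (isT : unit_step 0 1).
by case/unit_stepP: pq Sy => // Sy _ _; [left | right].
Qed.

(* With [u = (p, q)] and [v] its rotation, this is [2u + v]. *)
Definition chiral_step (s t : int) : Prop :=
  exists p q, [/\ unit_step p q, s = 2 * p - q & t = p + 3 * q].

Lemma chiral_step_rot s t : chiral_step s t -> chiral_step (- t) (s + t).
Proof.
move=> [p [q [pq -> ->]]]; exists (- q), (p + q).
by split; [exact: unit_step_rot | lia | lia].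
Qed.

Lemma perfect_code1_rot a b s t : chiral_step s t ->
  S (mk a b) -> S (mk (a + s) (b + t)) -> S (mk (a - t) (b + (s + t))).
Proof.
move=> [p [q [pq -> ->]]] Sx Sy.
have vpq := unit_step_rot pq; have wpq := unit_step_rot vpq.
have /dominated[c [d [cd Sz]]] : ~ S (mk (a - 2 * q) (b + 2 * (p + q))).
  by move=> Sz; have := apart Sx Sz vpq; case/unit_stepP: pq {Sx Sy Sz vpq wpq}.
have Sxz : S (mk (a + (c - 2 * q)) (b + (d + 2 * (p + q)))).
  by move: Sz; congr (S (mk _ _)); ring.
have Syz : S (mk (a + (2 * p - q) + (c - q - 2 * p))
                 (b + (p + 3 * q) + (d + p - q))).
  by move: Sz; congr (S (mk _ _)); ring.
(* Let [w = v - u] be the rotation of [v]. Every neighbour of [x + 2v] but [x + 2v + w] is within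
   distance 2 of [x], through [x + v], or of [y], through [y + w]. *)
have := apart Sx Sxz vpq; have := apart Sy Syz wpq.
have [/andP[/eqP cE /eqP dE] _ _|] := boolP ((c == - p - q) && (d == p)).
  by move: Sz; rewrite cE dE; congr (S (mk _ _)); ring.
by case/unit_stepP: pq {Sx Sy Sz Sxz Syz vpq wpq}; case/unit_stepP: cd.
Qed.

End PerfectCode.

(** * The model code *)

(** The sublattice spanned by [(2, 1)] and its rotation [(-1, 3)], of determinant 7, as the kernel
    of a map onto the integers modulo 7. *)
Definition tri_code : set tri_vertex := [set x | (7 %| 3 * cx x + cy x)%Z].

Lemma tri_codeE a b : tri_code (mk a b) = (7 %| 3 * a + b)%Z.
Proof. by []. Qed.

(* The six unit steps take the six nonzero values of [3 p + q] modulo 7. *)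
Lemma unit_step_mod7 (r : int) : ~~ (7 %| r)%Z ->
  exists p q, unit_step p q /\ (7 %| r + (3 * p + q))%Z.
Proof.
move=> r7; have : (r %% 7)%Z \in [:: 1; 2; 3; 4; 5; 6] by rewrite !inE; lia.
rewrite !inE; do ![case/orP|] => /eqP rE;
  [exists 0, (-1) | exists (-1), 1 | exists (-1), 0
  | exists 1, 0 | exists 1, (-1) | exists 0, 1]; split=> //; lia.
Qed.

Lemma unit_step_mod7_inj p q s t : unit_step p q -> unit_step s t ->
  (7 %| 3 * p + q - (3 * s + t))%Z -> p = s /\ q = t.
Proof. by case/unit_stepP; case/unit_stepP. Qed.

Lemma tri_code_perfect : perfect_code1 tri_adj tri_code.
Proof.
split=> [v|x y]; last first.
  rewrite -(mkK x) -(mkK y) tri_adjE !tri_codeE => x7 y7 /unit_stepP.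
  have : (7 %| 3 * (cx y - cx x) + (cy y - cy x))%Z by lia.
  by move=> /[swap]; case.
rewrite -(mkK v); move: (cx v) (cy v) => a b; rewrite tri_codeE.
move=> /negP ab; have [p [q [pq pq7]]] := unit_step_mod7 ab.
exists (mk (a + p) (b + q)); split.
  by rewrite tri_codeE tri_adjD; split=> //; lia.
move=> y; rewrite -(mkK y) tri_codeE tri_adjE => -[y7 uy].
have [|-> ->] := unit_step_mod7_inj pq uy; last by rewrite !subrKC.
by lia.
Qed.

Lemma tri_code_proper : proper_pds tri_adj tri_code.
Proof.
split; first exact: (proj1 tri_code_perfect).
move=> E; have : tri_code (mk 1 0) by rewrite E.
by rewrite tri_codeE.
Qed.

Lemma perfect_code1_eq_tri_code (S : set tri_vertex) :
  perfect_code1 tri_adj S -> S (mk 0 0) -> S (mk 2 1) -> S = tri_code.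
Proof.
move=> pcS S0 S21.
have codeS : tri_code `<=` S.
  move=> x; rewrite -(mkK x) tri_codeE; move: (cx x) (cy x) => a b ab.
  (* These solve [a = 2 i - j] and [b = i + 3 j], whence [3 a + b = 7 i]. *)
  pose i := ((3 * a + b) %/ 7)%Z; pose j := 2 * i - a.
  have -> : mk a b = mk (0 + i * 2 - j * 1) (0 + i * 1 + j * (2 + 1)).
    by rewrite /j /i; congr mk; lia.
  apply: (rotation_span chiral_step_rot (perfect_code1_rot pcS)) => //.
  by exists 1, 0.
(* An extra vertex of [S] would be adjacent to one of [tri_code], against independence. *)
apply/seteqP; split=> // x Sx; apply: contrapT.
move=> /(proj1 tri_code_perfect)[u [[/codeS Su xu] _]].
exact: (proj2 pcS) Sx Su xu.
Qed.

(** * Symmetries and classification *)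

Definition translation (a b : int) (x : tri_vertex) := mk (a + cx x) (b + cy x).
(** It swaps [(2, 1)] and [(1, 2)], hence the two chiralities. *)
Definition reflection (x : tri_vertex) := mk (cy x) (cx x).

Lemma translation_automorphism a b : automorphism tri_adj (translation a b).
Proof.
split.
  exists (translation (- a) (- b)) => x; rewrite /translation -[RHS]mkK;
    by congr mk; rewrite /cx /cy /=; lia.
move=> x y; rewrite -[in RHS](mkK x) -[in RHS](mkK y) /translation !tri_adjE.
by congr unit_step; ring.
Qed.

Lemma reflection_automorphism : automorphism tri_adj reflection.
Proof.
split; first by exists reflection => x; rewrite -[RHS]mkK.
move=> x y; rewrite -[in RHS](mkK x) -[in RHS](mkK y) /reflection !tri_adjE.
by rewrite /unit_step; lia.
Qed.

Lemma proper_pds_image_tri_code (T : set tri_vertex) f :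
  proper_pds tri_adj T -> automorphism tri_adj f ->
  T (f (mk 0 0)) -> T (f (mk 2 1)) -> T = f @` tri_code.
Proof.
move=> pT fA T0 T21; have pfT := proper_pds_preimage fA pT.
have pcfT : perfect_code1 tri_adj (f @^-1` T).
  by split; [exact: (proj1 pfT) | exact: proper_pds_independent].
rewrite -(perfect_code1_eq_tri_code pcfT T0 T21).
apply/seteqP; split=> [y Ty|_ [x Tx <-]//].
have [[g _ gK] _] := fA.
by exists (g y); rewrite /preimage /= gK.
Qed.

Theorem theorem1 :
  exists S : set tri_vertex,
    [/\ proper_pds tri_adj S,
        forall T : set tri_vertex, proper_pds tri_adj T ->
          exists f : tri_vertex -> tri_vertex,
            automorphism tri_adj f /\ T = f @` S,
        perfect_code1 tri_adj S
      & is_min_dist tri_adj S 3].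
Proof.
exists tri_code; split.
- exact: tri_code_proper.
- move=> T pT.
  have pcT : perfect_code1 tri_adj T.
    by split; [exact: (proj1 pT) | exact: proper_pds_independent].
  have [x] : exists x, T x.
    (* The origin, or else the vertex dominating it, lies in [T]. *)
    have [T0|/(proj1 pT)[u [[Tu _] _]]] := pselect (T (mk 0 0)).
      by exists (mk 0 0).
    by exists u.
  rewrite -(mkK x); move: (cx x) (cy x) => a b Tab.
  have tA := translation_automorphism a b.
  have Tab0 : T (translation a b (mk 0 0)) by rewrite /translation !addr0.
  have [T21|T12] := perfect_code1_chirality pcT Tab.
    by exists (translation a b); split=> //; exact: proper_pds_image_tri_code.
  have fA := automorphism_comp tA reflection_automorphism.
  by exists (translation a b \o reflection); split=> //;
    exact: proper_pds_image_tri_code.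
- exact: tri_code_perfect.
- have far x y n : tri_code x -> tri_code y -> x <> y ->
      walk tri_adj x y n -> (3 <= n)%N.
    exact: (perfect_code1_walk tri_adj_sym tri_code_perfect).
  split=> [|x y n Sx Sy xy [xyn _]]; last exact: far xyn.
  have S0 : tri_code (mk 0 0) by [].
  have S21 : tri_code (mk 2 1) by [].
  have n021 : mk 0 0 <> mk 2 1 by move=> /mk_inj[].
  exists (mk 0 0), (mk 2 1); split=> //; split; last by move=> n; exact: far.
  by exists [:: mk 1 0; mk 2 0; mk 2 1].
Qed.
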